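(* Let $\mathscr{T}$ be a strict topological theory and let $\Phi$ be a class of $\mathscr{T}$-distributors satisfying (Ax 1), (Ax 2), (Ax 3) and (Ax 4). Then the forgetful functor $G:\mathscr{T}\text{-}\mathsf{Cocont}_{\mathrm{sep}}^{\Phi}\to\mathbf{Set}$, sending a $\Phi$-cocomplete separated $\mathscr{T}$-category to its underlying set and a $\Phi$-cocontinuous $\mathscr{T}$-functor to its underlying map, is monadic.
   Context: **Topological theory.** $\mathscr{T}=(\mathbb{T},V,\xi)$ consists of: a commutative quantale $V=(V,\otimes,k)$ (complete lattice with commutative monoid structure, $\otimes$ preserving suprema in each variable); a $\mathbf{Set}$-monad $\mathbb{T}=(T,e,m)$ such that $T$ sends pullbacks to weak pullbacks and each naturality square of $m$ is a weak pullback; and a $\mathbb{T}$-algebra structure $\xi:TV\to V$ such that (a) $\otimes:V\times V\to V$ and $k:1\to V$ are $\mathbb{T}$-algebra homomorphisms, i.e. $\xi\cdot T(\otimes)=\otimes\cdot\langle\xi\cdot T\pi_1,\xi\cdot T\pi_2\rangle$ and $\xi\cdot Tk=k\cdot !$; (b) $\xi_X:V^X\to V^{TX}$, $\varphi\mapsto\xi\cdot T\varphi$, is a natural transformation $P\to PT$ of functors $\mathbf{Set}\to\mathbf{Ord}$, where $PX=V^X$ is ordered pointwise and $Pf(\varphi)(y)=\bigvee\{\varphi(x)\mid f(x)=y\}$. **$V$-relations.** A $V$-relation from $X$ to $Y$ is a map $r:X\times Y\to V$; composition is $(s\cdot r)(x,z)=\bigvee_y r(x,y)\otimes s(y,z)$,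 order is pointwise, $r^\circ(y,x)=r(x,y)$, and a map $f$ is regarded as the $V$-relation with value $k$ on its graph and $\bot$ elsewhere. Put $T_\xi r(\mathfrak{x},\mathfrak{y})=\bigvee\{\xi\cdot Tr(\mathfrak{w})\mid \mathfrak{w}\in T(X\times Y),T\pi_1(\mathfrak{w})=\mathfrak{x},T\pi_2(\mathfrak{w})=\mathfrak{y}\}$. A $\mathscr{T}$-relation $\alpha$ from $X$ to $Y$ is a $V$-relation from $TX$ to $Y$; the Kleisli convolution of $\alpha$ (from $X$ to $Y$) and $\beta$ (from $Y$ to $Z$) is $\beta\circ\alpha=\beta\cdot T_\xi\alpha\cdot m_X^\circ$. **$\mathscr{T}$-categories, functors, distributors.** A $\mathscr{T}$-category $(X,a)$ is a set $X$ with a $\mathscr{T}$-relation $a$ from $X$ to $X$ with $e_X^\circ\le a$ and $a\circ a\le a$. A $\mathscr{T}$-functor $f:(X,a)\to(Y,b)$ is a map with $a(\mathfrak{x},x)\le b(Tf(\mathfrak{x}),f(x))$. A $\mathscr{T}$-distributor $\varphi$ from $(X,a)$ to $(Y,b)$ is a $\mathscr{T}$-relation with $\varphi\circ a\le\varphi$ and $b\circ\varphi\le\varphi$; these compose by $\circ$, the identity on $(X,a)$ being $a$. A $\mathscr{T}$-functor $f$ induces distributors $f_*=b\cdot Tf$ (from $X$ to $Y$) and $f^*=f^\circ\cdot b$ (from $Y$ to $X$), with $f_*\dashv f^*$. For $f,g:X\to Y$, $f\le g$ means $f^*\le g^*$, and $f\cong g$ means $f^*=g^*$. $X$ is separated if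 $f\cong g$ implies $f=g$ for all $\mathscr{T}$-functors $f,g$ with codomain $X$. For distributors $\alpha$ from $X$ to $Y$ and $\gamma$ from $X$ to $Z$, $\gamma\mathbin{\circ\!-}\alpha$ is the largest distributor $\delta$ from $Y$ to $Z$ with $\delta\circ\alpha\le\gamma$. Write $(1,e_1^\circ)$ for the free $\mathscr{T}$-category on a one-element set $1$; each $y\in Y$ is viewed as a $\mathscr{T}$-functor $y:(1,e_1^\circ)\to Y$, so that $y^*\circ\varphi=\varphi(-,y)$ for a distributor $\varphi$ from $X$ to $Y$. **Axioms on $\Phi$.** (Ax 1) $f^*\in\Phi$ for each $\mathscr{T}$-functor $f$. (Ax 2) For $\varphi\in\Phi$ and each $\mathscr{T}$-functor $f$: $f^*\circ\varphi\in\Phi$, $\varphi\circ f^*\in\Phi$, and if $f_*\in\Phi$ then $\varphi\circ f_*\in\Phi$, whenever the compositions are defined. (Ax 3) For each distributor $\varphi$ from $X$ to $Y$: if $y^*\circ\varphi\in\Phi$ for all $y\in Y$, then $\varphi\in\Phi$. (Ax 4) $f_*\in\Phi$ for each surjective $\mathscr{T}$-functor $f$. **$\Phi$-notions.** For a $\mathscr{T}$-functor $h:Y\to X$ and a distributor $\varphi$ from $Y$ to $Z$, a colimit $\mathrm{colim}(\varphi,h)$ is a $\mathscr{T}$-functor $g:Z\to X$ with $g_*=h_*\mathbin{\circ\!-}\varphi$. $X$ is $\Phi$-cocomplete if $\mathrm{colim}(\varphi,h)$ exists for all such $h$ and all such $\varphi\in\Phi$. A $\mathscr{T}$-functor $f:X\to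 Y$ is $\Phi$-cocontinuous if it preserves all existing $\Phi$-weighted colimits, i.e. $f\cdot\mathrm{colim}(\varphi,h)\cong\mathrm{colim}(\varphi,f\cdot h)$ for $\varphi\in\Phi$. $\mathscr{T}\text{-}\mathsf{Cocont}_{\mathrm{sep}}^{\Phi}$ is the category of $\Phi$-cocomplete separated $\mathscr{T}$-categories and $\Phi$-cocontinuous $\mathscr{T}$-functors. *)

(* Defs.v *)
From HB Require Import structures.
From mathcomp Require Import all_boot all_order.
From mathcomp Require Import boolp classical_sets.

Set Implicit Arguments.
Unset Strict Implicit.
Unset Printing Implicit Defensive.

Import Order.TTheory.
Local Open Scope classical_set_scope.
Local Open Scope order_scope.

Declare Scope cat_scope.
Local Open Scope cat_scope.

(** * Categories, adjunctions and monadicity *)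

Record category := Category {
  obj :> Type;
  hom : obj -> obj -> Type;
  idm : forall A, hom A A;
  mcomp : forall A B C, hom B C -> hom A B -> hom A C;
  mcomp1m : forall A B (f : hom A B), mcomp (idm B) f = f;
  mcompm1 : forall A B (f : hom A B), mcomp f (idm A) = f;
  mcompA : forall A B C D (h : hom C D) (g : hom B C) (f : hom A B),
    mcomp h (mcomp g f) = mcomp (mcomp h g) f }.

Arguments hom {c} _ _.
Arguments idm {c} A.
Arguments mcomp {c A B C} _ _.
Notation "g '\oc' f" := (mcomp g f) (at level 50, left associativity) :
  cat_scope.

Record functor (C D : category) := Functor {
  fobj :> C -> D;
  fmap : forall A B : C, hom A B -> hom (fobj A) (fobj B);
  fmap1 : forall A, fmap (idm A) = idm (fobj A);
  fmapM : forall (A B E : C) (g : hom B E) (f : hom A B),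
    fmap (g \oc f) = fmap g \oc fmap f }.

Arguments fmap {C D} f0 {A B} _.

Definition id_functor (C : category) : functor C C :=
  @Functor C C (fun A => A) (fun A B f => f)
    (fun _ => erefl) (fun _ _ _ _ _ => erefl).

Program Definition comp_functor (C D E : category)
    (G : functor D E) (F : functor C D) : functor C E :=
  @Functor C E (fun A => G (F A)) (fun A B f => fmap G (fmap F f)) _ _.
Next Obligation. by rewrite !fmap1. Qed.
Next Obligation. by rewrite !fmapM. Qed.

Definition natural (C D : category) (F G : functor C D)
    (t : forall A, hom (F A) (G A)) : Prop :=
  forall (A B : C) (f : hom A B), t B \oc fmap F f = fmap G f \oc t A.

Definition nat_isomorphic (C D : category) (F G : functor C D) : Prop :=
  exists (t : forall A, hom (F A) (G A)) (s : forall A, hom (G A) (F A)),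
    [/\ natural t, forall A, s A \oc t A = idm (F A)
      & forall A, t A \oc s A = idm (G A)].

Definition is_equivalence (C D : category) (K : functor C D) : Prop :=
  exists L : functor D C,
    nat_isomorphic (comp_functor L K) (id_functor C) /\
    nat_isomorphic (comp_functor K L) (id_functor D).

Record monad (C : category) := Monad {
  mfun :> functor C C;
  munit : forall X : C, hom X (mfun X);
  mmul : forall X : C, hom (mfun (mfun X)) (mfun X);
  munit_nat : forall (X Y : C) (f : hom X Y),
    munit Y \oc f = fmap mfun f \oc munit X;
  mmul_nat : forall (X Y : C) (f : hom X Y),
    mmul Y \oc fmap mfun (fmap mfun f) = fmap mfun f \oc mmul X;
  mmul1m : forall X, mmul X \oc munit (mfun X) = idm (mfun X);
  mmulm1 : forall X, mmul X \oc fmap mfun (munit X) = idm (mfun X);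
  mmulA : forall X,
    mmul X \oc mmul (mfun X) = mmul X \oc fmap mfun (mmul X) }.

Arguments munit {C} m X.
Arguments mmul {C} m X.

Definition is_algebra (C : category) (M : monad C) (X : C) (h : hom (M X) X) :
    Prop :=
  h \oc munit M X = idm X /\ h \oc mmul M X = h \oc fmap M h.

Section EilenbergMoore.
Variables (C : category) (M : monad C).

Record algebra := Algebra {
  alg_carrier : C;
  alg_act : hom (M alg_carrier) alg_carrier;
  algP : is_algebra alg_act }.

Record alg_hom (A B : algebra) := AlgHom {
  alg_map : hom (alg_carrier A) (alg_carrier B);
  alg_mapP : alg_map \oc alg_act A = alg_act B \oc fmap M alg_map }.

Lemma alg_hom_eq (A B : algebra) (f g : alg_hom A B) :
  alg_map f = alg_map g -> f = g.
Proof.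
case: f g => [f hf] [g hg] /= efg; subst g.
by rewrite (Prop_irrelevance hf hg).
Qed.

Program Definition alg_id (A : algebra) : alg_hom A A :=
  @AlgHom A A (idm _) _.
Next Obligation. by rewrite fmap1 mcomp1m mcompm1. Qed.

Program Definition alg_comp (A B D : algebra) (g : alg_hom B D)
    (f : alg_hom A B) : alg_hom A D :=
  @AlgHom A D (alg_map g \oc alg_map f) _.
Next Obligation. by rewrite fmapM -mcompA alg_mapP !mcompA alg_mapP. Qed.

Program Definition EM_category : category :=
  @Category algebra alg_hom alg_id alg_comp _ _ _.
Next Obligation. by apply: alg_hom_eq; rewrite /= mcomp1m. Qed.
Next Obligation. by apply: alg_hom_eq; rewrite /= mcompm1. Qed.
Next Obligation. by apply: alg_hom_eq; rewrite /= mcompA. Qed.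

End EilenbergMoore.

Section Monadic.
Variables (A C : category) (G : functor A C).

Record left_adjoint := LeftAdjoint {
  ladj :> functor C A;
  adj_unit : forall X : C, hom X (G (ladj X));
  adj_counit : forall Y : A, hom (ladj (G Y)) Y;
  adj_unit_nat : forall (X X' : C) (f : hom X X'),
    adj_unit X' \oc f = fmap G (fmap ladj f) \oc adj_unit X;
  adj_counit_nat : forall (Y Y' : A) (f : hom Y Y'),
    adj_counit Y' \oc fmap ladj (fmap G f) = f \oc adj_counit Y;
  adj_triangleG : forall Y : A,
    fmap G (adj_counit Y) \oc adj_unit (G Y) = idm (G Y);
  adj_triangleF : forall X : C,
    adj_counit (ladj X) \oc fmap ladj (adj_unit X) = idm (ladj X) }.

Variable F : left_adjoint.

Program Definition adj_monad : monad C :=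
  @Monad C (comp_functor G F) (adj_unit F)
    (fun X => fmap G (adj_counit F (F X))) _ _ _ _ _.
Next Obligation. exact: adj_unit_nat. Qed.
Next Obligation. by rewrite -!fmapM adj_counit_nat. Qed.
Next Obligation. exact: adj_triangleG. Qed.
Next Obligation. by rewrite -fmapM adj_triangleF fmap1. Qed.
Next Obligation. by rewrite -!fmapM adj_counit_nat. Qed.

Program Definition comparison : functor A (EM_category adj_monad) :=
  @Functor A (EM_category adj_monad)
    (fun Y => @Algebra C adj_monad (G Y) (fmap G (adj_counit F Y)) _)
    (fun Y Y' f => @AlgHom C adj_monad _ _ (fmap G f) _) _ _.
Next Obligation.
by split; rewrite /= ?adj_triangleG // -!fmapM adj_counit_nat.
Qed.
Next Obligation. by rewrite -!fmapM adj_counit_nat. Qed.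
Next Obligation. by apply: alg_hom_eq; rewrite /= fmap1. Qed.
Next Obligation. by apply: alg_hom_eq; rewrite /= fmapM. Qed.

End Monadic.

(* Monadicity up to equivalence, not up to isomorphism, of the comparison. *)
Definition monadic (A C : category) (G : functor A C) : Prop :=
  exists F : left_adjoint G, is_equivalence (comparison F).

Section Squares.
Variables (C : category) (P X Y Z : C).
Variables (p : hom P X) (q : hom P Y) (f : hom X Z) (g : hom Y Z).

Definition is_pullback : Prop :=
  f \oc p = g \oc q /\
  forall (W : C) (u : hom W X) (v : hom W Y), f \oc u = g \oc v ->
    exists! w : hom W P, p \oc w = u /\ q \oc w = v.

Definition is_weak_pullback : Prop :=
  f \oc p = g \oc q /\
  forall (W : C) (u : hom W X) (v : hom W Y), f \oc u = g \oc v ->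
    exists w : hom W P, p \oc w = u /\ q \oc w = v.

End Squares.

Definition SetCat : category :=
  @Category Type (fun A B => A -> B) (fun A x => x)
    (fun A B C g f x => g (f x))
    (fun _ _ _ => erefl) (fun _ _ _ => erefl) (fun _ _ _ _ _ _ _ => erefl).

(** * Topological theories *)

Record quantale := Quantale {
  qdisp : Order.disp_t;
  qcarrier :> porderType qdisp;
  qunit : qcarrier;
  qtens : Monoid.com_law qunit;
  qsup : set qcarrier -> qcarrier;
  qsupP : forall A : set qcarrier, supremums A (qsup A);
  (* preservation in the first variable follows by commutativity *)
  qtens_sup : forall (a : qcarrier) (A : set qcarrier),
    qtens a (qsup A) = qsup [set qtens a b | b in A] }.

Arguments qunit {q}.
Arguments qtens {q}.
Arguments qsup {q} _.

Definition qbot (V : quantale) : V := qsup set0.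

(* The action on maps of the functor P : Set -> Ord, X |-> V^X. *)
Definition Pmap (V : quantale) (X Y : Type) (f : X -> Y) (phi : X -> V) :
    Y -> V :=
  fun y => qsup [set phi x | x in [set x | f x = y]].

Definition setmap (M : monad SetCat) (X Y : Type) (f : X -> Y) :
    M X -> M Y :=
  @fmap SetCat SetCat M X Y f.

Record strict_topological_theory := StrictTopologicalTheory {
  thV : quantale;
  thT : monad SetCat;
  thT_BC : forall (P X Y Z : SetCat) (p : hom P X) (q : hom P Y)
      (f : hom X Z) (g : hom Y Z),
    is_pullback p q f g ->
    is_weak_pullback (fmap thT p) (fmap thT q) (fmap thT f) (fmap thT g);
  thm_BC : forall (X Y : SetCat) (f : hom X Y),
    is_weak_pullback (mmul thT X) (fmap thT (fmap thT f))
      (fmap thT f) (mmul thT Y);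
  thxi : thT thV -> thV;
  thxi_alg : @is_algebra SetCat thT thV thxi;
  thxi_tens : forall w : thT (thV * thV)%type,
    thxi (setmap (fun v => qtens v.1 v.2) w) =
    qtens (thxi (setmap fst w)) (thxi (setmap snd w));
  thxi_unit : forall w : thT unit, thxi (setmap (fun=> qunit) w) = qunit;
  (* phi |-> xi . T phi is a map of ordered sets P X -> P (T X), natural in X *)
  thxi_mono : forall (X : Type) (phi psi : X -> thV),
    (forall x, phi x <= psi x) ->
    forall t : thT X, thxi (setmap phi t) <= thxi (setmap psi t);
  thxi_nat : forall (X Y : Type) (f : X -> Y) (phi : X -> thV) (t : thT Y),
    thxi (setmap (Pmap f phi) t) =
    Pmap (@setmap thT X Y f) (fun u => thxi (setmap phi u)) t }.

Section Theory.
Variable th : strict_topological_theory.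
Local Notation V := (thV th).

Definition TT (X : Type) : Type := thT th X.
Definition Tmap (X Y : Type) (f : X -> Y) : TT X -> TT Y := setmap f.
Definition Te (X : Type) : X -> TT X := munit (thT th) X.
Definition Tm (X : Type) : TT (TT X) -> TT X := mmul (thT th) X.
Definition xi : TT V -> V := @thxi th.

(** ** V-relations *)

Definition vrel (X Y : Type) := X * Y -> V.

Definition vle (X Y : Type) (r s : vrel X Y) : Prop := forall p, r p <= s p.

(* [vcomp s r] is "r first, then s". *)
Definition vcomp (X Y Z : Type) (s : vrel Y Z) (r : vrel X Y) : vrel X Z :=
  fun p => qsup (range (fun y => qtens (r (p.1, y)) (s (y, p.2)))).

Definition vconv (X Y : Type) (r : vrel X Y) : vrel Y X :=
  fun p => r (p.2, p.1).

Definition vgraph (X Y : Type) (f : X -> Y) : vrel X Y :=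
  fun p => if `[< f p.1 = p.2 >] then qunit else qbot V.

Definition Txi (X Y : Type) (r : vrel X Y) : vrel (TT X) (TT Y) :=
  fun p => qsup [set xi (Tmap r w) |
    w in [set w : TT (X * Y) | Tmap fst w = p.1 /\ Tmap snd w = p.2]].

(** ** T-relations, T-categories, T-functors, T-distributors *)

Definition trel (X Y : Type) := vrel (TT X) Y.

Definition kleisli (X Y Z : Type) (beta : trel Y Z) (alpha : trel X Y) :
    trel X Z :=
  vcomp (vcomp beta (Txi alpha)) (vconv (vgraph (@Tm X))).

Record tcat := TCat {
  tcar :> Type;
  tstr : trel tcar tcar;
  tstr_refl : vle (vconv (vgraph (@Te tcar))) tstr;
  tstr_trans : vle (kleisli tstr tstr) tstr }.

Arguments tstr : clear implicits.

Definition is_tfunctor (X Y : tcat) (f : X -> Y) : Prop :=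
  forall (t : TT X) (x : X), tstr X (t, x) <= tstr Y (Tmap f t, f x).

Record tfunctor (X Y : tcat) := TFunctor {
  tfun :> X -> Y;
  tfunP : is_tfunctor tfun }.

Definition is_tdistributor (X Y : tcat) (phi : trel X Y) : Prop :=
  vle (kleisli phi (tstr X)) phi /\ vle (kleisli (tstr Y) phi) phi.

Definition lower_star (X Y : tcat) (f : tfunctor X Y) : trel X Y :=
  vcomp (tstr Y) (vgraph (Tmap f)).

Definition upper_star (X Y : tcat) (f : tfunctor X Y) : trel Y X :=
  vcomp (vconv (vgraph f)) (tstr Y).

Definition tiso (X Y : tcat) (f g : tfunctor X Y) : Prop :=
  upper_star f = upper_star g.

Definition separated (X : tcat) : Prop :=
  forall (A : tcat) (f g : tfunctor A X), tiso f g -> f = g.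

(* [is_rext gamma alpha delta] : delta is the largest distributor with
   delta o alpha <= gamma, i.e. delta = gamma o- alpha. *)
Definition is_rext (X Y Z : tcat) (gamma : trel X Z) (alpha : trel X Y)
    (delta : trel Y Z) : Prop :=
  [/\ is_tdistributor delta, vle (kleisli delta alpha) gamma
    & forall delta' : trel Y Z, is_tdistributor delta' ->
        vle (kleisli delta' alpha) gamma -> vle delta' delta].

Lemma tfunctor_eq (X Y : tcat) (f g : tfunctor X Y) :
  tfun f = tfun g -> f = g.
Proof.
case: f g => [f hf] [g hg] /= efg; subst g.
by rewrite (Prop_irrelevance hf hg).
Qed.


Lemma TmapM (X Y Z : Type) (g : Y -> Z) (f : X -> Y) (t : TT X) :
  Tmap (fun x => g (f x)) t = Tmap g (Tmap f t).
Proof.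
exact: (congr1 (fun h => h t) (@fmapM _ _ (thT th) X Y Z g f)).
Qed.

Lemma Tmap_id (X : Type) (t : TT X) : Tmap (fun x => x) t = t.
Proof. exact: (congr1 (fun h => h t) (@fmap1 _ _ (thT th) X)). Qed.

Lemma Tmap_e (X Y : Type) (f : X -> Y) (x : X) : Tmap f (Te x) = Te (f x).
Proof.
by symmetry; apply: (congr1 (fun h => h x) (@munit_nat _ (thT th) X Y f)).
Qed.

Lemma Tm_e (X : Type) (t : TT X) : Tm (Te t) = t.
Proof. exact: (congr1 (fun h => h t) (mmul1m (thT th) X)). Qed.

Lemma Tm_Te (X : Type) (t : TT X) : Tm (Tmap (@Te X) t) = t.
Proof. exact: (congr1 (fun h => h t) (mmulm1 (thT th) X)). Qed.

Lemma xi_e (v : V) : xi (Te v) = v.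
Proof. by case: (thxi_alg th) => /(congr1 (fun h => h v)). Qed.

Lemma qsup_ub (W : quantale) (A : set W) (a : W) : A a -> a <= qsup A.
Proof. by move=> Aa; have [+ _] := qsupP A; apply. Qed.

Lemma qsup_le (W : quantale) (A : set W) (b : W) :
  (forall a, A a -> a <= b) -> qsup A <= b.
Proof. by move=> ub; have [_ +] := qsupP A; apply. Qed.

Lemma qbot_le (W : quantale) (a : W) : qbot W <= a.
Proof. exact: qsup_le. Qed.

Lemma qtens_bot (W : quantale) (a : W) : qtens a (qbot W) = qbot W.
Proof. by rewrite /qbot qtens_sup image_set0. Qed.

Lemma qtensC (W : quantale) (a b : W) : qtens a b = qtens b a.
Proof. exact: Monoid.mulmC. Qed.

Lemma qtens1 (W : quantale) (a : W) : qtens a qunit = a.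
Proof. exact: Monoid.mulm1. Qed.

Lemma q1tens (W : quantale) (a : W) : qtens qunit a = a.
Proof. exact: Monoid.mul1m. Qed.

Lemma qtens_mono (W : quantale) (a b c : W) :
  b <= c -> qtens a b <= qtens a c.
Proof.
move=> bc.
have <- : qsup [set b; c] = c.
  apply/le_anti/andP; split; last by apply: qsup_ub; right.
  by apply: qsup_le => x [->|->].
by rewrite qtens_sup; apply: qsup_ub; exists b => //; left.
Qed.

Lemma vconvE (X Y : Type) (r : vrel X Y) (x : X) (y : Y) :
  vconv r (y, x) = r (x, y).
Proof. by []. Qed.

Lemma graph_true (X Y : Type) (f : X -> Y) (x : X) :
  vgraph f (x, f x) = qunit.
Proof. by rewrite /vgraph /= (asboolT (erefl (f x))). Qed.

Lemma graph_false (X Y : Type) (f : X -> Y) (x : X) (y : Y) :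
  f x <> y -> vgraph f (x, y) = qbot V.
Proof. by move=> /asboolF; rewrite /vgraph /= => ->. Qed.

Program Definition tid (X : tcat) : tfunctor X X := @TFunctor X X id _.
Next Obligation. by move=> t x; rewrite Tmap_id. Qed.

Program Definition tcomp (X Y Z : tcat) (g : tfunctor Y Z)
    (f : tfunctor X Y) : tfunctor X Z :=
  @TFunctor X Z (fun x => g (f x)) _.
Next Obligation.
move=> t x; rewrite TmapM.
by apply: le_trans (tfunP f t x) _; apply: tfunP.
Qed.

(* The free T-category on a set X. *)
Program Definition free_tcat (X : Type) : tcat :=
  @TCat X (vconv (vgraph (@Te X))) _ _.
Next Obligation. by move=> p. Qed.
Next Obligation.
move=> [s z]; apply: qsup_le => _ [t _ <-] /=.
rewrite !vconvE.
have [mt|mt] := EM (Tm t = s); last first.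
  by rewrite (graph_false mt) qtensC qtens_bot qbot_le.
rewrite -{1}mt graph_true q1tens; apply: qsup_le => _ [u _ <-] /=.
rewrite vconvE.
have [eu|eu] := EM (Te z = u); last first.
  by rewrite (graph_false eu) qtens_bot qbot_le.
rewrite -{2}eu graph_true qtens1.
apply: qsup_le => _ [w [/= w1 w2] <-].
have -> : vconv (vgraph (@Te X)) =
          Pmap (fun x => (Te x, x)) (fun=> qunit : V).
  apply/funext => -[t' x]; rewrite vconvE.
  apply/le_anti/andP; split; last first.
    by apply: qsup_le => _ [y /= [<- ->] <-]; rewrite graph_true.
  have [e|e] := EM (Te x = t'); last by rewrite (graph_false e) qbot_le.
  by rewrite -{1}e graph_true; apply: qsup_ub; exists x => //=; rewrite e.
rewrite /xi /Tmap thxi_nat; apply: qsup_le => _ [v /= vw <-].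
have -> : thxi (setmap (fun=> qunit) v) = qunit :> V.
  rewrite -[RHS](thxi_unit (Tmap (fun=> tt) v)).
  exact: (congr1 (@thxi th) (TmapM (fun=> qunit : V) (fun=> tt) v)).
suff -> : s = Te z by rewrite [leRHS]graph_true.
rewrite -mt -w1 -vw eu -w2 -vw.
rewrite -[X in Tm X]/(Tmap fst (Tmap (fun x => (Te x, x)) v)) -TmapM.
rewrite [LHS]Tm_Te -[RHS]/(Tmap snd (Tmap (fun x => (Te x, x)) v)) -TmapM.
exact/esym/Tmap_id.
Qed.

Definition tone : tcat := free_tcat unit.

Program Definition tpoint (Y : tcat) (y : Y) : tfunctor tone Y :=
  @TFunctor tone Y (fun=> y) _.
Next Obligation.
move=> t u; rewrite [leLHS]/= [leLHS]vconvE.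
have [<-|e] := EM (Te u = t); last by rewrite (graph_false e) qbot_le.
rewrite graph_true Tmap_e; apply: le_trans (tstr_refl (Te y, y)).
by rewrite [leRHS]graph_true.
Qed.

(** ** Classes of distributors *)

(* T-distributors are not bundled: a class of distributors is a predicate on
   T-relations between T-categories that only holds of distributors, so that
   membership can be asserted of a Kleisli convolution directly. *)

Record dist_class := DistClass {
  dmem :> forall X Y : tcat, trel X Y -> Prop;
  dmemP : forall (X Y : tcat) (phi : trel X Y),
    dmem phi -> is_tdistributor phi }.

Arguments dmem : clear implicits.

Variable Phi : dist_class.
Local Notation inPhi X Y phi := (dmem Phi X Y phi).

Definition Ax1 : Prop :=
  forall (X Y : tcat) (f : tfunctor X Y), inPhi Y X (upper_star f).

Definition Ax2 : Prop :=
  forall (X Y : tcat) (phi : trel X Y), inPhi X Y phi ->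
    [/\ forall (A : tcat) (f : tfunctor A Y),
          inPhi X A (kleisli (upper_star f) phi),
        forall (B : tcat) (f : tfunctor X B),
          inPhi B Y (kleisli phi (upper_star f))
      & forall (A : tcat) (f : tfunctor A X),
          inPhi A X (lower_star f) -> inPhi A Y (kleisli phi (lower_star f))].

Definition Ax3 : Prop :=
  forall (X Y : tcat) (phi : trel X Y), is_tdistributor phi ->
    (forall y : Y, inPhi X tone (kleisli (upper_star (tpoint y)) phi)) ->
    inPhi X Y phi.

Definition Ax4 : Prop :=
  forall (X Y : tcat) (f : tfunctor X Y),
    (forall y : Y, exists x : X, f x = y) -> inPhi X Y (lower_star f).

(** ** Weighted colimits *)

Definition is_colim (X Y Z : tcat) (phi : trel Y Z) (h : tfunctor Y X)
    (g : tfunctor Z X) : Prop :=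
  is_rext (lower_star h) phi (lower_star g).

Definition cocomplete (X : tcat) : Prop :=
  forall (Y Z : tcat) (phi : trel Y Z) (h : tfunctor Y X), inPhi Y Z phi ->
    exists g : tfunctor Z X, is_colim phi h g.

Definition cocontinuous (X Y : tcat) (f : tfunctor X Y) : Prop :=
  forall (A B : tcat) (phi : trel A B) (h : tfunctor A X)
      (g : tfunctor B X),
    inPhi A B phi -> is_colim phi h g ->
    exists g' : tfunctor B Y,
      is_colim phi (tcomp f h) g' /\ tiso (tcomp f g) g'.

Lemma upper_starE (X Y : tcat) (f : tfunctor X Y) (t : TT Y) (x : X) :
  upper_star f (t, x) = tstr Y (t, f x).
Proof.
apply/le_anti/andP; split; last first.
  apply: qsup_ub; exists (f x) => //=.
  by rewrite [X in qtens _ X]graph_true qtens1.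
apply: qsup_le => _ [y _ <-] /=.
rewrite vconvE.
have [<-|e] := EM (f x = y); first by rewrite graph_true qtens1.
by rewrite (graph_false e) qtens_bot qbot_le.
Qed.

Lemma tstr_e (X : tcat) (x : X) : qunit <= tstr X (Te x, x).
Proof.
by apply: le_trans (tstr_refl (Te x, x)); rewrite [leRHS]graph_true.
Qed.

Lemma tstr_compose (X : tcat) (t : TT X) (x y : X) :
  qtens (tstr X (t, x)) (tstr X (Te x, y)) <= tstr X (t, y).
Proof.
apply: le_trans (tstr_trans (t, y)); apply: le_trans (qsup_ub _); last first.
  by exists (Te t).
have E : vconv (vgraph (@Tm X)) (t, Te t) = qunit.
  by rewrite vconvE -[X in (_, X)](Tm_e t) graph_true.
rewrite /= E q1tens.
apply: le_trans (qsup_ub _); last by exists (Te x).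
rewrite /= qtensC [leRHS]qtensC; apply: qtens_mono.
apply: qsup_ub; exists (Te (t, x)); first by rewrite /= !Tmap_e.
by rewrite Tmap_e xi_e.
Qed.

Lemma tiso_le (X Y : tcat) (f g : tfunctor X Y) (t : TT Y) (x : X) :
  tiso f g -> tstr Y (t, f x) = tstr Y (t, g x).
Proof. by move=> fg; rewrite -!upper_starE fg. Qed.

Lemma tiso_compl (X Y Z : tcat) (h : tfunctor Y Z) (f g : tfunctor X Y) :
  tiso f g -> tiso (tcomp h f) (tcomp h g).
Proof.
have le u v t x : tiso u v ->
    tstr Z (t, h (u x)) <= tstr Z (t, h (v x)).
  move=> uv; apply: le_trans (tstr_compose t (h (u x)) (h (v x))).
  rewrite -[leLHS]qtens1; apply: qtens_mono.
  rewrite -Tmap_e; apply: le_trans (tfunP h _ _).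
  by rewrite -(tiso_le _ _ uv) tstr_e.
move=> fg; apply/funext => -[t x]; rewrite !upper_starE /=.
by apply/le_anti; rewrite !le //; exact: esym.
Qed.

Lemma cocontinuous_id (X : tcat) : cocontinuous (tid X).
Proof.
have tcomp1m A (u : tfunctor A X) : tcomp (tid X) u = u.
  exact: tfunctor_eq.
by move=> A B phi h g _ cg; exists g; rewrite /tiso !tcomp1m.
Qed.

Lemma cocontinuous_comp (X Y Z : tcat) (g : tfunctor Y Z)
    (f : tfunctor X Y) :
  cocontinuous g -> cocontinuous f -> cocontinuous (tcomp g f).
Proof.
move=> gc fc A B phi h k phiP /(fc _ _ _ _ _ phiP) [k1 [k1c k1i]].
have [k2 [k2c k2i]] := gc _ _ _ _ _ phiP k1c.
exists k2; split; first exact: k2c.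
by rewrite /tiso -k2i; apply: (tiso_compl g k1i).
Qed.

(** ** The category of separated cocomplete T-categories *)

Record cocont_obj := CocontObj {
  cocont_tcat :> tcat;
  cocont_sep : separated cocont_tcat;
  cocont_cocomplete : cocomplete cocont_tcat }.

Record cocont_hom (X Y : cocont_obj) := CocontHom {
  cocont_fun :> tfunctor X Y;
  cocont_funP : cocontinuous cocont_fun }.

Lemma cocont_hom_eq (X Y : cocont_obj) (f g : cocont_hom X Y) :
  (f : X -> Y) = g -> f = g.
Proof.
case: f g => [f hf] [g hg] /= /tfunctor_eq efg; subst g.
by rewrite (Prop_irrelevance hf hg).
Qed.

Program Definition Cocont_sep : category :=
  @Category cocont_obj cocont_hom
    (fun X => CocontHom (@cocontinuous_id X))
    (fun X Y Z g f =>
       CocontHom (cocontinuous_comp (cocont_funP g) (cocont_funP f))) _ _ _.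
Next Obligation. exact: cocont_hom_eq. Qed.
Next Obligation. exact: cocont_hom_eq. Qed.
Next Obligation. exact: cocont_hom_eq. Qed.

Definition forgetful : functor Cocont_sep SetCat :=
  @Functor Cocont_sep SetCat (fun X : cocont_obj => X : Type)
    (fun X Y (f : cocont_hom X Y) => tfun f)
    (fun _ => erefl) (fun _ _ _ _ _ => erefl).

End Theory.

(* Main.v *)
From mathcomp Require Import all_boot all_order.
From mathcomp Require Import boolp classical_sets.
Require Import Defs.

(** Monadicity rests on two facts: the free object on a set is the T-category
of presheaves in Phi on the discrete T-category, and every algebra for the
induced monad is the quotient of a free object by a closure operator.

Presheaves.  A Kleisli convolution [kleisli beta alpha] is the composite of
[beta] with an extension [sharp alpha] of [alpha], and [sharp] is compatible
with convolution ([sharp_kleisli]), by the weak pullback conditions, the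
naturality of xi and its compatibility with the tensor.  Hence convolution is
associative, and right extensions [lres] can be composed.  The set of
presheaves in Phi carries the T-structure [lres eval eval], where [eval] is
the evaluation relation.  With this definition a distributor in Phi corresponds to a T-functor into presheaves
([mate]), the Yoneda embedding is the mate of the T-structure, and
[lower_star yoneda = eval] is the identity [lres_str].  Colimits of presheaves
are convolutions ([psh_colim]), and the left Kan extension along Yoneda is the
unique cocontinuous extension ([psh_extend], [psh_extend_unique]).

Algebras.  By [Ax4] a surjective cocontinuous T-functor f has a T-functor g as
right inverse, with 1 <= g f ([surjective_section]).  Let q : F X -> X
be an algebra, with u = F q and v = the counit, both from F (F X) to F X.
Both are surjective and cocontinuous, so they have such right inverses u' and
v'.  The composite n = v u' u v' is a T-functor that sends every element of
F X to the largest element of its q-fibre ([fibre_closure]).  Hence X is in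
bijection with the fixed points of the closure operator n; it inherits a
T-structure for which q is a left adjoint, thus cocontinuous, and it is
separated and cocomplete because it is reflective in F X
([closure_quotient]).  As q is then the counit at X, the comparison functor is
surjective on objects up to isomorphism.  It is full since a map that becomes
cocontinuous after composition with the split quotient F Y -> Y is itself
cocontinuous ([quotient_cocontinuous]). *)

Set Implicit Arguments.
Unset Strict Implicit.
Unset Printing Implicit Defensive.

Import Order.TTheory.
Local Open Scope classical_set_scope.
Local Open Scope order_scope.

(** * Universal arrows and equivalences of categories *)

Local Open Scope cat_scope.

Section UniversalArrows.
Variables (A C : category) (G : functor A C) (P : C -> A).
Variable eta : forall X : C, hom X (G (P X)).
Hypothesis eta_univ : forall (X : C) (Y : A) (f : hom X (G Y)),
  exists h : hom (P X) Y, fmap G h \oc eta X = f.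
Hypothesis eta_inj : forall (X : C) (Y : A) (h k : hom (P X) Y),
  fmap G h \oc eta X = fmap G k \oc eta X -> h = k.

Definition extend (X : C) (Y : A) (f : hom X (G Y)) : hom (P X) Y :=
  sval (cid (eta_univ f)).

Lemma extendE (X : C) (Y : A) (f : hom X (G Y)) :
  fmap G (extend f) \oc eta X = f.
Proof. exact: svalP (cid (eta_univ f)). Qed.

Program Definition free_functor : functor C A :=
  @Functor C A P (fun X X' f => extend (eta X' \oc f)) _ _.
Next Obligation. by apply: eta_inj; rewrite extendE fmap1 mcomp1m mcompm1. Qed.
Next Obligation.
by apply: eta_inj; rewrite extendE fmapM -mcompA extendE !mcompA extendE.
Qed.

Program Definition universal_left_adjoint : left_adjoint G :=
  @LeftAdjoint A C G free_functor eta (fun Y => extend (idm (G Y))) _ _ _ _.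
Next Obligation. by rewrite extendE. Qed.
Next Obligation.
apply: eta_inj.
by rewrite !fmapM -mcompA extendE mcompA -[RHS]mcompA !extendE mcomp1m mcompm1.
Qed.
Next Obligation. exact: extendE. Qed.
Next Obligation.
apply: eta_inj.
by rewrite fmapM -mcompA extendE mcompA extendE fmap1 !mcomp1m.
Qed.

End UniversalArrows.

(** The transpose of a map along the adjunction recovers the map. *)
Lemma adj_unit_inj (A C : category) (G : functor A C) (F : left_adjoint G)
    (X : C) (Y : A) (h k : hom (F X) Y) :
  fmap G h \oc adj_unit F X = fmap G k \oc adj_unit F X -> h = k.
Proof.
have transpose (l : hom (F X) Y) :
    adj_counit F Y \oc fmap F (fmap G l \oc adj_unit F X) = l.
  by rewrite fmapM mcompA adj_counit_nat -mcompA adj_triangleF mcompm1.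
by move=> hk; rewrite -[h]transpose hk transpose.
Qed.

Section Equivalence.
Variables (C D : category) (K : functor C D).
Hypothesis K_faithful : forall (A B : C) (f g : hom A B),
  fmap K f = fmap K g -> f = g.
Hypothesis K_full : forall (A B : C) (h : hom (K A) (K B)),
  exists f, fmap K f = h.
Hypothesis K_surj : forall X : D, exists (A : C) (i : hom (K A) X)
  (j : hom X (K A)), i \oc j = idm X /\ j \oc i = idm (K A).

Definition preimage (X : D) : C := sval (cid (K_surj X)).

Lemma preimage_iso (X : D) :
  exists ij : hom (K (preimage X)) X * hom X (K (preimage X)),
  ij.1 \oc ij.2 = idm X /\ ij.2 \oc ij.1 = idm (K (preimage X)).
Proof. by have [i [j ij]] := svalP (cid (K_surj X)); exists (i, j). Qed.

Definition iso_to (X : D) := (sval (cid (preimage_iso X))).1.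
Definition iso_from (X : D) := (sval (cid (preimage_iso X))).2.

Lemma iso_toK (X : D) : iso_from X \oc iso_to X = idm (K (preimage X)).
Proof. by case: (svalP (cid (preimage_iso X))). Qed.

Lemma iso_fromK (X : D) : iso_to X \oc iso_from X = idm X.
Proof. by case: (svalP (cid (preimage_iso X))). Qed.

Definition lift (A B : C) (h : hom (K A) (K B)) : hom A B :=
  sval (cid (K_full h)).

Lemma liftE (A B : C) (h : hom (K A) (K B)) : fmap K (lift h) = h.
Proof. exact: svalP (cid (K_full h)). Qed.

Program Definition inverse_functor : functor D C :=
  @Functor D C preimage (fun X Y h => lift (iso_from Y \oc h \oc iso_to X)) _ _.
Next Obligation. by apply: K_faithful; rewrite liftE fmap1 mcompm1 iso_toK. Qed.
Next Obligation.
apply: K_faithful; rewrite fmapM !liftE -!mcompA; congr (_ \oc (_ \oc _)).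
by rewrite [RHS]mcompA iso_fromK mcomp1m.
Qed.

(** The inverse functor exists by choice of an object and of an isomorphism over
each object of the target. *)
Lemma fully_faithful_equivalence : is_equivalence K.
Proof.
exists inverse_functor; split.
  exists (fun A => lift (iso_to (K A))), (fun A => lift (iso_from (K A))).
  split=> [A B f|A|A]; apply: K_faithful; rewrite /= !fmapM !liftE.
  - by rewrite -mcompA mcompA iso_fromK mcomp1m.
  - by rewrite fmap1 iso_toK.
  - by rewrite fmap1 iso_fromK.
exists iso_to, iso_from; split=> [X Y f|X|X] /=.
- by rewrite liftE -mcompA mcompA iso_fromK mcomp1m.
- exact: iso_toK.
- exact: iso_fromK.
Qed.

End Equivalence.

Local Close Scope cat_scope.

(** * Suprema in a quantale *)

Lemma eq_from_above (d : Order.disp_t) (T : porderType d) (a b : T) :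
  (forall c, a <= c <-> b <= c) -> a = b.
Proof.
by move=> ab; apply/le_anti/andP; split; [apply/ab | apply/ab].
Qed.

Lemma eq_from_below (d : Order.disp_t) (T : porderType d) (a b : T) :
  (forall c, c <= a <-> c <= b) -> a = b.
Proof.
by move=> ab; apply/le_anti/andP; split; [apply/ab | apply/ab].
Qed.

Lemma tens_sup_leP (V : quantale) (a c : V) (A : set V) :
  qtens a (qsup A) <= c <-> forall b, A b -> qtens a b <= c.
Proof.
rewrite qtens_sup; split=> [le_c b Ab | le_c].
  by apply: le_trans le_c; apply: qsup_ub; exists b.
by apply: qsup_le => _ [b Ab <-]; apply: le_c.
Qed.

Lemma tens_mono (V : quantale) (a b c d : V) :
  a <= c -> b <= d -> qtens a b <= qtens c d.
Proof.
move=> ac bd; apply: le_trans (qtens_mono _ bd) _.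
by rewrite qtensC [leRHS]qtensC; apply: qtens_mono.
Qed.

Lemma tensA (V : quantale) (a b c : V) :
  qtens a (qtens b c) = qtens (qtens a b) c.
Proof. exact: Monoid.mulmA. Qed.

(** The internal hom of the quantale; it turns a bound on a product with a
supremum into a bound on the supremum alone. *)
Definition qres (V : quantale) (a c : V) : V :=
  qsup [set b | qtens a b <= c].

Lemma le_qres (V : quantale) (a b c : V) : (b <= qres a c) = (qtens a b <= c).
Proof.
apply/idP/idP => [b_ac | ab_c]; last exact: qsup_ub.
by apply: le_trans (qtens_mono a b_ac) _; apply/tens_sup_leP.
Qed.

Section Calculus.
Variable th : strict_topological_theory.
Local Notation V := (thV th).
Local Notation T := (TT th).
Local Notation e := (Te th).

(** * The monad and the algebra on the quantale, in terms of elements *)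

Lemma eq_Tmap (X Y : Type) (f g : X -> Y) (t : T X) :
  (forall x, f x = g x) -> Tmap f t = Tmap g t.
Proof. by move=> /funext ->. Qed.

Lemma Tm_nat (X Y : Type) (f : X -> Y) (t : T (T X)) :
  Tm (Tmap (Tmap f) t) = Tmap f (Tm t).
Proof. exact: (congr1 (fun h => h t) (@mmul_nat _ (thT th) X Y f)). Qed.

Lemma Tm_assoc (X : Type) (t : T (T (T X))) :
  Tm (Tm t) = Tm (Tmap (@Tm th X) t).
Proof. exact: (congr1 (fun h => h t) (@mmulA _ (thT th) X)). Qed.

(** The elementwise form in which preservation of weak pullbacks is used. *)
Lemma T_pullback (P X Y Z : Type) (p : P -> X) (q : P -> Y) (f : X -> Z)
    (g : Y -> Z) (s : T X) (t : T Y) :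
    (forall w, f (p w) = g (q w)) ->
    (forall x y, f x = g y -> exists w, p w = x /\ q w = y) ->
    (forall w w', p w = p w' -> q w = q w' -> w = w') ->
  Tmap f s = Tmap g t -> exists w : T P, Tmap p w = s /\ Tmap q w = t.
Proof.
move=> fpgq surj inj fsgt.
have pb : @is_pullback SetCat P X Y Z p q f g.
  split=> [|W u v fugv]; first by apply/funext => w; apply: fpgq.
  have /choice [h hP] : forall w, exists z, p z = u w /\ q z = v w.
    by move=> w; apply: surj; apply: (congr1 (fun k => k w) fugv).
  exists h; split=> [|k [pk qk]].
    by split; apply/funext => w; case: (hP w).
  apply/funext => w; case: (hP w) => pw qw.
  by apply: inj; rewrite ?pw ?qw -?pk -?qk.
have [_ weak] := thT_BC th pb.
have [|w [pw qw]] := weak unit (fun=> s) (fun=> t).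
  by apply/funext => u; apply: fsgt.
exists (w tt).
by split; [move/(congr1 (@^~ tt)): pw | move/(congr1 (@^~ tt)): qw].
Qed.

Lemma Tm_pullback (X Y : Type) (f : X -> Y) (s : T X) (t : T (T Y)) :
  Tmap f s = Tm t -> exists w : T (T X), Tm w = s /\ Tmap (Tmap f) w = t.
Proof.
move=> fsmt; have [_ weak] := @thm_BC th X Y f.
have [|w [pw qw]] := weak unit (fun=> s) (fun=> t).
  by apply/funext => u; apply: fsmt.
exists (w tt).
by split; [move/(congr1 (@^~ tt)): pw | move/(congr1 (@^~ tt)): qw].
Qed.

Lemma xi_m (w : T (T V)) : xi (Tm w) = xi (Tmap (@xi th) w).
Proof. by case: (thxi_alg th) => _ /(congr1 (fun h => h w)). Qed.

Lemma xi_tens (X : Type) (f g : X -> V) (t : T X) :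
  xi (Tmap (fun x => qtens (f x) (g x)) t) =
  qtens (xi (Tmap f t)) (xi (Tmap g t)).
Proof.
rewrite (TmapM (fun v : V * V => qtens v.1 v.2) (fun x => (f x, g x))).
by rewrite /xi /Tmap thxi_tens -![setmap _ (setmap _ _)]TmapM.
Qed.

Lemma xi_unit (X : Type) (t : T X) : xi (Tmap (fun=> qunit) t) = qunit :> V.
Proof. by rewrite (TmapM (fun=> qunit) (fun=> tt)) /xi /Tmap thxi_unit. Qed.

Lemma xi_mono (X : Type) (f g : X -> V) (t : T X) :
  (forall x, f x <= g x) -> xi (Tmap f t) <= xi (Tmap g t).
Proof. by move=> fg; apply: thxi_mono. Qed.

Lemma xi_Pmap (X Y : Type) (f : X -> Y) (phi : X -> V) (t : T Y) :
  xi (Tmap (Pmap f phi) t) =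
  qsup [set xi (Tmap phi u) | u in [set u | Tmap f u = t]].
Proof. exact: thxi_nat. Qed.

(** * Kleisli convolution as composition with an extension *)

(** The Kleisli extension: [Txi alpha] after the converse of the
multiplication. *)
Definition sharp (X Y : Type) (alpha : trel th X Y) : vrel th (T X) (T Y) :=
  fun p => qsup [set xi (Tmap alpha w) | w in
    [set w : T (T X * Y) | Tm (Tmap fst w) = p.1 /\ Tmap snd w = p.2]].

Lemma sharp_ub (X Y : Type) (alpha : trel th X Y) (w : T (T X * Y)) :
  xi (Tmap alpha w) <= sharp alpha (Tm (Tmap fst w), Tmap snd w).
Proof. by apply: qsup_ub; exists w. Qed.

(** The convolution is the V-relation composite of [sharp alpha] and [beta],
described by its upper bounds. *)
Lemma kleisli_leP (X Y Z : Type) (beta : trel th Y Z) (alpha : trel th X Y)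
    (t : T X) (z : Z) (v : V) :
  kleisli beta alpha (t, z) <= v <->
  forall s, qtens (beta (s, z)) (sharp alpha (t, s)) <= v.
Proof.
split=> [le_v s | le_v].
  apply/tens_sup_leP => _ [w [/= wt ws] <-]; apply: le_trans le_v.
  apply: le_trans (qsup_ub _); last by exists (Tmap fst w).
  rewrite /= vconvE -{1}wt graph_true q1tens.
  apply: le_trans (qsup_ub _); last by exists s.
  rewrite /= qtensC; apply: tens_mono => //.
  by apply: qsup_ub; exists w.
apply: qsup_le => _ [t' _ <-] /=; rewrite vconvE.
have [tt'|tt'] := EM (Tm t' = t); last first.
  by rewrite (graph_false _ tt') qtensC qtens_bot qbot_le.
rewrite -{1}tt' graph_true q1tens; apply: qsup_le => _ [s _ <-] /=.
rewrite qtensC; apply: le_trans (le_v s); apply: qtens_mono.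
apply: qsup_le => _ [w [/= wt ws] <-]; apply: qsup_ub; exists w => //=.
by rewrite wt.
Qed.

Lemma kleisli_ub (X Y Z : Type) (beta : trel th Y Z) (alpha : trel th X Y)
    (t : T X) (s : T Y) (z : Z) :
  qtens (beta (s, z)) (sharp alpha (t, s)) <= kleisli beta alpha (t, z).
Proof. by move: s; apply/kleisli_leP. Qed.

(** The witness is the image of t under x |-> (e x, x): its first projection is
the image of t under T e, which the multiplication sends to t. *)
Lemma sharp_unit (X : Type) (alpha : trel th X X) (t : T X) :
  (forall x, qunit <= alpha (e x, x)) -> qunit <= sharp alpha (t, t).
Proof.
move=> refl; have := sharp_ub alpha (Tmap (fun x => (e x, x)) t).
rewrite -!TmapM /= Tmap_id [X in Tm X]/(Tmap (@Te th X) t) Tm_Te.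
by apply: le_trans; rewrite -(xi_unit t); apply: xi_mono.
Qed.

Lemma sharp_e (X Y : Type) (alpha : trel th X Y) (t : T X) (y : Y) :
  alpha (t, y) <= sharp alpha (t, e y).
Proof.
by have := sharp_ub alpha (e (t, y)); rewrite !Tmap_e /= Tm_e xi_e.
Qed.

Lemma sharp_map (X Y X' Y' : Type) (alpha : trel th X Y)
    (beta : trel th X' Y') (f : X -> X') (g : Y -> Y') :
  (forall t y, alpha (t, y) <= beta (Tmap f t, g y)) ->
  forall t s, sharp alpha (t, s) <= sharp beta (Tmap f t, Tmap g s).
Proof.
move=> le_ab t s; apply: qsup_le => _ [w [/= wt ws] <-].
have := sharp_ub beta (Tmap (fun p => (Tmap f p.1, g p.2)) w).
rewrite -!TmapM /= (TmapM g snd) ws (TmapM (Tmap f) fst) Tm_nat wt.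
by apply: le_trans; apply: xi_mono => -[t' y].
Qed.

(** One inequality is monotonicity; the other lifts an element of T (T X * Y)
along f, by preservation of the pullback of f and the second projection. *)
Lemma sharp_comap (X Y Z : Type) (alpha : trel th X Y) (f : Z -> Y) (t : T X)
    (s : T Z) :
  sharp alpha (t, Tmap f s) = sharp (fun p => alpha (p.1, f p.2)) (t, s).
Proof.
apply/le_anti/andP; split; last first.
  have := @sharp_map X Z X Y (fun p => alpha (p.1, f p.2)) alpha id f.
  by move=> /(_ _ t s); rewrite Tmap_id; apply=> t' z; rewrite Tmap_id.
apply: qsup_le => _ [w [/= wt ws] <-].
have [||[t' z] [t'' z']|w' [w1 w2]] := @T_pullback (T X * Z) (T X * Y) Z Y
    (fun p => (p.1, f p.2)) snd snd f w s _ _ _ ws.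
- by [].
- by case=> t' y z /= ->; exists (t', z).
- by move=> [-> _] /= ->.
rewrite -w1 -TmapM; apply: qsup_ub; exists w' => //=; split=> //.
by rewrite -wt -w1 -TmapM.
Qed.

(** Naturality of xi applies to direct images only.  This writes the convolution
as a direct image, indexed by the pairs of an element of T (T X * Y) and a
point of Z. *)
Lemma kleisli_Pmap (X Y Z : Type) (beta : trel th Y Z) (alpha : trel th X Y) :
  kleisli beta alpha =
  Pmap (fun j : T (T X * Y) * Z => (Tm (Tmap fst j.1), j.2))
    (fun j => qtens (beta (Tmap snd j.1, j.2)) (xi (Tmap alpha j.1))).
Proof.
apply/funext => -[t z]; apply/le_anti/andP; split.
  apply/kleisli_leP => s; apply/tens_sup_leP => _ [w [/= wt ws] <-].
  by apply: qsup_ub; exists (w, z); rewrite /= ?wt ?ws.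
apply: qsup_le => _ [[w z'] /= [<- <-] <-].
apply: le_trans (kleisli_ub _ _ _ (Tmap snd w) _).
by apply: qtens_mono; apply: sharp_ub.
Qed.

(** The extension of a convolution is the composite of the extensions.  By
[kleisli_Pmap] and naturality of xi, the left side is a supremum over elements
om of T (T (T X * Y) * Z); the right side is one over pairs w1, w2 of elements
of T (T X * Y) and T (T Y * Z) that agree over some s in T Y.  An om yields w1
by the multiplication and w2 by projection, and conversely the two weak
pullback conditions build om from w1 and w2. *)
Lemma sharp_kleisli (X Y Z : Type) (beta : trel th Y Z) (alpha : trel th X Y)
    (t : T X) (u : T Z) (v : V) :
  sharp (kleisli beta alpha) (t, u) <= v <->
  forall s, qtens (sharp beta (s, u)) (sharp alpha (t, s)) <= v.
Proof.
split=> [le_v s | le_v].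
  apply/tens_sup_leP => _ [w1 [/= w1t w1s] <-].
  rewrite qtensC; apply/tens_sup_leP => _ [w2 [/= w2s w2u] <-].
  apply: le_trans le_v.
  (* first split w1 along the multiplication, then glue with w2 *)
  have [W [Ww1 Ww2]] :=
    @Tm_pullback _ _ snd w1 (Tmap fst w2) (etrans w1s (esym w2s)).
  have [|||om [om1 om2]] := @T_pullback (T (T X * Y) * Z) (T (T X * Y))
      (T Y * Z) (T Y) fst (fun j => (Tmap snd j.1, j.2)) (Tmap snd) fst W w2
      _ _ _ Ww2.
  - by [].
  - by move=> a [b z] /= <-; exists (a, z).
  - by move=> [a z] [a' z'] /= <- [->].
  apply: le_trans (qsup_ub _); last first.
    exists (Tmap (fun j => (Tm (Tmap fst j.1), j.2)) om) => //=; split.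
      rewrite -TmapM /= (TmapM (fun a => Tm (Tmap fst a)) fst) om1.
      rewrite (TmapM (@Tm th X) (Tmap fst)) -Tm_assoc Tm_nat Ww1.
      exact: w1t.
    by rewrite -w2u -om2 -!TmapM.
  rewrite -TmapM.
  (* one term of the supremum that defines the convolution *)
  pose term (j : T (T X * Y) * Z) :=
    qtens (beta (Tmap snd j.1, j.2)) (xi (Tmap alpha j.1)).
  apply: (@le_trans _ _ (xi (Tmap term om))); last first.
    by apply: xi_mono => j; rewrite kleisli_Pmap; apply: qsup_ub; exists j.
  rewrite xi_tens (TmapM beta (fun j => (Tmap snd j.1, j.2))) om2 qtensC.
  apply: qtens_mono.
  rewrite (TmapM (@xi th) (fun j => Tmap alpha j.1)) -xi_m.
  by rewrite (TmapM (Tmap alpha) fst) om1 Tm_nat Ww1.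
apply: qsup_le => _ [W [/= Wt Wu] <-].
rewrite kleisli_Pmap xi_Pmap; apply: qsup_le => _ [om /= omW <-].
rewrite xi_tens (TmapM beta (fun j => (Tmap snd j.1, j.2))).
rewrite (TmapM (@xi th) (fun j => Tmap alpha j.1)) -xi_m.
rewrite (TmapM (Tmap alpha) fst) Tm_nat.
apply: le_trans (le_v (Tmap snd (Tm (Tmap fst om)))); apply: tens_mono.
  apply: qsup_ub; exists (Tmap (fun j => (Tmap snd j.1, j.2)) om) => //=; split.
    by rewrite -TmapM /= -Tm_nat -TmapM.
  by rewrite -Wu -omW -!TmapM.
apply: qsup_ub; exists (Tm (Tmap fst om)) => //=; split=> //.
rewrite -Wt -omW -TmapM /= -Tm_nat Tm_assoc -TmapM -TmapM.
by congr Tm; apply: eq_Tmap => j /=; rewrite -Tm_nat.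
Qed.

Lemma kleisliA (X Y Z W : Type) (gamma : trel th Z W) (beta : trel th Y Z)
    (alpha : trel th X Y) :
  kleisli (kleisli gamma beta) alpha = kleisli gamma (kleisli beta alpha).
Proof.
apply/funext => -[t z]; apply: eq_from_above => v.
rewrite !kleisli_leP; split=> le_v s.
  rewrite -le_qres; apply/sharp_kleisli => s'; rewrite le_qres.
  rewrite tensA qtensC; apply: le_trans (le_v s'); rewrite qtensC.
  by apply: tens_mono => //; apply: kleisli_ub.
rewrite qtensC -le_qres; apply/kleisli_leP => s'; rewrite le_qres.
rewrite qtensC -tensA; apply: le_trans (le_v s'); apply: qtens_mono.
by move: s; apply/sharp_kleisli.
Qed.

(** * Right extensions *)

(** The largest T-relation delta with [kleisli delta alpha] below [gamma].  The
value at (s, z) involves only the column of [gamma] at z, which makes right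
extensions compatible with reindexing on the right. *)
Definition lres (X Y Z : Type) (gamma : trel th X Z) (alpha : trel th X Y) :
    trel th Y Z :=
  fun p => qsup [set v |
    forall t, qtens v (sharp alpha (t, p.1)) <= gamma (t, p.2)].

Lemma le_lres (X Y Z : Type) (gamma : trel th X Z) (alpha : trel th X Y)
    (s : T Y) (z : Z) (v : V) :
  v <= lres gamma alpha (s, z) <->
  forall t, qtens v (sharp alpha (t, s)) <= gamma (t, z).
Proof.
split=> [le_v t | le_v]; last exact: qsup_ub.
apply: le_trans (tens_mono le_v (lexx _)) _.
by rewrite qtensC; apply/tens_sup_leP => b /(_ t); rewrite qtensC.
Qed.

Lemma lresP (X Y Z : Type) (gamma : trel th X Z) (alpha : trel th X Y)
    (delta : trel th Y Z) :
  vle (kleisli delta alpha) gamma <-> vle delta (lres gamma alpha).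
Proof.
split=> [le_g [s z] | le_d [t z]].
  by apply/le_lres => t; apply: le_trans (kleisli_ub _ _ _ _ _) (le_g (t, z)).
by apply/kleisli_leP => s; move: t; apply/le_lres; apply: le_d.
Qed.

(** The adjoint form of associativity of convolution. *)
Lemma lres_comp (X Y Z W : Type) (gamma : trel th X W) (alpha : trel th X Y)
    (phi : trel th Y Z) :
  lres gamma (kleisli phi alpha) = lres (lres gamma alpha) phi.
Proof.
apply/funext => -[u z]; apply: eq_from_below => v; rewrite !le_lres.
split=> [le_g s | le_g t].
  apply/le_lres => t; apply: le_trans (le_g t); rewrite -tensA.
  by apply: qtens_mono; move: s; apply/sharp_kleisli.
rewrite -le_qres; apply/sharp_kleisli => s; rewrite le_qres tensA.
by move: t; apply/le_lres; apply: le_g.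
Qed.

(** * Distributors and right extensions *)

Lemma vle_anti (X Y : Type) (r s : vrel th X Y) : vle r s -> vle s r -> r = s.
Proof. by move=> rs sr; apply/funext => p; apply/le_anti; rewrite rs sr. Qed.

Lemma vle_trans (X Y : Type) (r s t : vrel th X Y) :
  vle r s -> vle s t -> vle r t.
Proof. by move=> rs st p; apply: le_trans (rs p) (st p). Qed.

Lemma kleisli_monor (X Y Z : Type) (beta : trel th Y Z)
    (alpha alpha' : trel th X Y) :
  vle alpha alpha' -> vle (kleisli beta alpha) (kleisli beta alpha').
Proof.
move=> le_aa [t z]; apply/kleisli_leP => s.
apply: le_trans (kleisli_ub _ _ _ s _); apply: qtens_mono.
have := @sharp_map X Y X Y alpha alpha' id id.
by move=> /(_ _ t s); rewrite !Tmap_id; apply=> t' y; rewrite Tmap_id.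
Qed.

Lemma le_kleisli_unitr (X Y : Type) (phi : trel th X Y) (a : trel th X X) :
  (forall x, qunit <= a (e x, x)) -> vle phi (kleisli phi a).
Proof.
move=> refl [t y]; apply: le_trans (kleisli_ub _ _ _ t _).
by rewrite -[leLHS]qtens1; apply/qtens_mono/sharp_unit.
Qed.

Lemma le_kleisli_unitl (X Y : Type) (phi : trel th X Y) (b : trel th Y Y) :
  (forall y, qunit <= b (e y, y)) -> vle phi (kleisli b phi).
Proof.
move=> refl [t y]; apply: le_trans (kleisli_ub _ _ _ (e y) _).
by rewrite -[leLHS]q1tens; apply: tens_mono (refl y) (sharp_e _ _ _).
Qed.

Lemma kleisli_strr (X Y : tcat th) (phi : trel th X Y) :
  is_tdistributor phi -> kleisli phi (@tstr th X) = phi.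
Proof.
by case=> phiX _; apply: vle_anti => //; apply: le_kleisli_unitr (@tstr_e _ X).
Qed.

Lemma kleisli_strl (X Y : tcat th) (phi : trel th X Y) :
  is_tdistributor phi -> kleisli (@tstr th Y) phi = phi.
Proof.
by case=> _ phiY; apply: vle_anti => //; apply: le_kleisli_unitl (@tstr_e _ Y).
Qed.

Lemma lres_distributor (X Y Z : tcat th) (gamma : trel th X Z)
    (alpha : trel th X Y) :
  is_tdistributor gamma -> is_tdistributor alpha ->
  @is_tdistributor th Y Z (lres gamma alpha).
Proof.
move=> [_ gZ] [_ aY].
have le_g : vle (kleisli (lres gamma alpha) alpha) gamma by apply/lresP.
split; apply: (proj1 (lresP _ _ _)); rewrite kleisliA.
  by apply: vle_trans le_g; apply: kleisli_monor.
by apply: vle_trans gZ; apply: kleisli_monor.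
Qed.

(** The largest T-relation is already a distributor, so that it is also the
largest distributor. *)
Lemma is_rextP (X Y Z : tcat th) (gamma : trel th X Z) (alpha : trel th X Y)
    (delta : trel th Y Z) :
  is_tdistributor gamma -> is_tdistributor alpha ->
  is_rext gamma alpha delta <-> delta = lres gamma alpha.
Proof.
move=> dg da; have dl := lres_distributor dg da; split=> [[_ dag max]|->].
  by apply: vle_anti; [apply/lresP | apply: max => //; apply/lresP].
by split=> [//||delta' _ /lresP]; first by apply/lresP.
Qed.

(** The T-structure is the identity for convolution, hence right extension along
it does nothing. *)
Lemma lres_str (X Y : tcat th) (gamma : trel th X Y) :
  is_tdistributor gamma -> lres gamma (@tstr th X) = gamma.
Proof.
move=> dg; apply: vle_anti.
  have le_k := le_kleisli_unitr (lres gamma (@tstr th X)) (@tstr_e _ X).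
  exact: vle_trans le_k (proj2 (lresP _ _ _) _).
by apply/lresP; rewrite kleisli_strr.
Qed.

Lemma lower_starE (X Y : tcat th) (f : tfunctor X Y) (t : T X) (y : Y) :
  lower_star f (t, y) = @tstr th Y (Tmap f t, y).
Proof.
apply/le_anti/andP; split; last first.
  apply: qsup_ub; exists (Tmap f t) => //=.
  by rewrite [X in qtens X _]graph_true q1tens.
apply: qsup_le => _ [s _ <-] /=.
have [<-|fts] := EM (Tmap f t = s); first by rewrite graph_true q1tens.
by rewrite (graph_false _ fts) qtensC qtens_bot qbot_le.
Qed.

Lemma lower_star_distributor (X Y : tcat th) (f : tfunctor X Y) :
  is_tdistributor (lower_star f).
Proof.
split=> -[t y]; rewrite [leRHS]lower_starE.
  apply/kleisli_leP => s; rewrite lower_starE.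
  apply: le_trans (tstr_trans (Tmap f t, y)).
  apply: le_trans (kleisli_ub _ _ _ (Tmap f s) _); apply: qtens_mono.
  by apply: sharp_map => t' x; apply: tfunP.
apply/kleisli_leP => s.
apply: le_trans (tstr_trans (Tmap f t, y)).
apply: le_trans (kleisli_ub _ _ _ s _); apply: qtens_mono.
rewrite -[s in leRHS]Tmap_id; apply: sharp_map => t' x.
by rewrite lower_starE.
Qed.

Lemma kleisli_upper_star (X Y Z : tcat th) (f : tfunctor Z Y)
    (phi : trel th X Y) (t : T X) (z : Z) :
  is_tdistributor phi -> kleisli (upper_star f) phi (t, z) = phi (t, f z).
Proof.
move=> /kleisli_strl phiE; rewrite -{2}phiE; apply: eq_from_above => v.
by rewrite !kleisli_leP; split=> le_v s; have := le_v s; rewrite upper_starE.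
Qed.

Lemma is_colimP (X Y Z : tcat th) (phi : trel th Y Z) (h : tfunctor Y X)
    (g : tfunctor Z X) :
  is_tdistributor phi ->
  is_colim phi h g <-> lower_star g = lres (lower_star h) phi.
Proof. by move=> dphi; apply: is_rextP (lower_star_distributor h) dphi. Qed.

(** * The underlying order *)

(** For T-functors out of the one-point T-category this is the order of the
induced distributors; separatedness is its antisymmetry. *)
Definition tle (X : tcat th) (x y : X) : Prop := qunit <= @tstr th X (e x, y).

Lemma tle_str (X : tcat th) (t : T X) (x y : X) :
  tle x y -> @tstr th X (t, x) <= @tstr th X (t, y).
Proof.
move=> xy; apply: le_trans (tstr_compose t x y).
by rewrite -[leLHS]qtens1; apply: qtens_mono.
Qed.

Lemma tle_refl (X : tcat th) (x : X) : tle x x.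
Proof. exact: tstr_e. Qed.

Lemma tle_trans (X : tcat th) (x y z : X) : tle x y -> tle y z -> tle x z.
Proof. by move=> xy yz; apply: le_trans xy (tle_str _ yz). Qed.

Lemma tle_mono (X Y : tcat th) (f : tfunctor X Y) (x y : X) :
  tle x y -> tle (f x) (f y).
Proof. by move=> xy; apply: le_trans xy _; rewrite -Tmap_e; apply: tfunP. Qed.

Lemma separatedP (X : tcat th) :
  separated X <-> forall x y : X, tle x y -> tle y x -> x = y.
Proof.
split=> [sepX x y xy yx | anti A f g fg].
  suff pt_xy : tiso (tpoint x) (tpoint y).
    exact: (congr1 (fun h : tfunctor (tone th) X => h tt) (sepX _ _ _ pt_xy)).
  apply/funext => -[t u]; rewrite !upper_starE /=.
  by apply/le_anti; rewrite !tle_str.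
apply: tfunctor_eq; apply/funext => a; apply: anti.
  by rewrite /tle -(tiso_le _ _ fg); apply: tstr_e.
by rewrite /tle (tiso_le _ _ fg); apply: tstr_e.
Qed.

Lemma lower_star_inj (X Y : tcat th) (f g : tfunctor X Y) :
  separated Y -> lower_star f = lower_star g -> f = g.
Proof.
move=> /separatedP anti fg; apply: tfunctor_eq; apply/funext => x.
have fgE t y : @tstr th Y (Tmap f t, y) = @tstr th Y (Tmap g t, y).
  by rewrite -!lower_starE fg.
apply: anti; rewrite /tle -Tmap_e; [rewrite fgE | rewrite -fgE].
all: by rewrite Tmap_e; apply: tstr_e.
Qed.

(** Left adjoints preserve colimits: the adjunction identifies the two right
extensions at y with those at g y. *)
Lemma adjoint_colim (X Y A B : tcat th) (f : tfunctor X Y) (g : tfunctor Y X)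
    (phi : trel th A B) (h : tfunctor A X) (k : tfunctor B X) :
    (forall t y, @tstr th Y (Tmap f t, y) = @tstr th X (t, g y)) ->
  is_tdistributor phi -> is_colim phi h k ->
  is_colim phi (tcomp f h) (tcomp f k).
Proof.
move=> adj dphi /(is_colimP _ _ dphi) kE; apply/(is_colimP _ _ dphi).
have fE C (l : tfunctor C X) t y :
    lower_star (tcomp f l) (t, y) = lower_star l (t, g y).
  by rewrite !lower_starE /= TmapM adj.
apply/funext => -[s y]; rewrite fE kE; apply: eq_from_below => v.
rewrite !le_lres.
by split=> le_v t; have := le_v t; rewrite fE.
Qed.

(** * The T-category of presheaves in a class of distributors *)

Section Presheaves.
Variable Phi : dist_class th.

Lemma dmem_ext (X Y : tcat th) (phi psi : trel th X Y) :
  (forall t y, phi (t, y) = psi (t, y)) ->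
  @dmem th Phi X Y phi -> @dmem th Phi X Y psi.
Proof.
by move=> phipsi; have -> : phi = psi by apply/funext => -[].
Qed.

Definition presheaf (X : tcat th) : Type :=
  {psi : trel th X unit | @dmem th Phi X (tone th) psi}.

Lemma presheaf_eq (X : tcat th) (f g : presheaf X) :
  (forall t, sval f (t, tt) = sval g (t, tt)) -> f = g.
Proof.
by case: f g => [f fP] [g gP] /= fg; apply: eq_exist; apply/funext => -[t []].
Qed.

Definition eval (X : tcat th) : trel th X (presheaf X) :=
  fun p => sval p.2 (p.1, tt).

(** [eval] along the point psi is psi itself, and psi absorbs the T-structure of
the one-point T-category. *)
Lemma eval_e (X : tcat th) (psi : presheaf X) (t : T X) :
  sharp (@eval X) (t, e psi) <= sval psi (t, tt).
Proof.
rewrite -(Tmap_e _ (fun=> psi) tt) sharp_comap.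
have [_ dpsi] := dmemP (svalP psi); apply: le_trans (dpsi (t, tt)).
have -> : (fun p => eval (p.1, psi)) = sval psi by apply/funext => -[? []].
apply: le_trans (kleisli_ub _ _ _ (e tt) _).
by rewrite -[leLHS]q1tens; apply: tens_mono => //; apply: (@tstr_e _ (tone th)).
Qed.

Lemma kleisli_lres_eval (X : tcat th) :
  vle (kleisli (lres (@eval X) (@eval X)) (@eval X)) (@eval X).
Proof. exact/lresP. Qed.

(** Reflexivity is [eval_e]; transitivity is the universal property of right
extensions together with associativity of convolution. *)
Program Definition psh (X : tcat th) : tcat th :=
  @TCat th (presheaf X) (lres (@eval X) (@eval X)) _ _.
Next Obligation.
move=> [p psi]; rewrite [leLHS]vconvE.
have [<-|ep] := EM (e psi = p); last by rewrite (graph_false _ ep) qbot_le.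
by rewrite graph_true; apply/le_lres => t; rewrite q1tens; apply: eval_e.
Qed.
Next Obligation.
apply: (proj1 (lresP _ _ _)); rewrite kleisliA.
have le_ev := @kleisli_lres_eval X.
exact: vle_trans (kleisli_monor _ le_ev) le_ev.
Qed.

Lemma eval_distributor (X : tcat th) : @is_tdistributor th X (psh X) (@eval X).
Proof.
split; last exact: kleisli_lres_eval.
move=> [t psi]; have [dpsi _] := dmemP (svalP psi).
by apply: le_trans (dpsi (t, tt)); apply/kleisli_leP => s; apply: kleisli_ub.
Qed.

Lemma psh_separated (X : tcat th) : separated (psh X).
Proof.
apply/separatedP => f g fg gf; apply: presheaf_eq => t; apply/le_anti/andP.
have le_fg (f' g' : psh X) : tle f' g' -> sval f' (t, tt) <= sval g' (t, tt).
  move=> /le_lres/(_ t); apply: le_trans.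
  by rewrite q1tens; apply: (sharp_e (@eval X)).
by split; apply: le_fg.
Qed.

Lemma lres_eval_map (X Z : tcat th) (Y : Type) (gamma : trel th X Y)
    (g : tfunctor Z (psh X)) (s : T Z) (y : Y) :
  lres gamma (@eval X) (Tmap g s, y) =
  lres gamma (fun p => eval (p.1, g p.2)) (s, y).
Proof.
apply: eq_from_below => v; rewrite !le_lres.
have sE t := sharp_comap (@eval X) g t s.
by split=> le_v t; have := le_v t; rewrite sE.
Qed.

(** A T-functor into presheaves is determined by the relation whose columns are
its values, and its lower star is the right extension along that relation. *)
Lemma lower_star_psh (X Z : tcat th) (g : tfunctor Z (psh X)) :
  lower_star g = lres (@eval X) (fun p => eval (p.1, g p.2)).
Proof.
by apply/funext => -[s psi]; rewrite lower_starE; apply: lres_eval_map.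
Qed.

Hypotheses (hAx1 : Ax1 Phi) (hAx2 : Ax2 Phi) (hAx3 : Ax3 Phi).

Section Mate.
Variables (X Z : tcat th) (phi : trel th X Z) (phiP : @dmem th Phi X Z phi).

Lemma column_mem (z : Z) : @dmem th Phi X (tone th) (fun p => phi (p.1, z)).
Proof.
have [/(_ _ (tpoint z)) + _ _] := hAx2 phiP; apply: dmem_ext => t u.
by rewrite kleisli_upper_star //; apply: dmemP phiP.
Qed.

(** Currying turns the T-functor inequality into [kleisli b phi <= phi], where b
is the T-structure of Z. *)
Lemma mate_tfunctor :
  @is_tfunctor th Z (psh X) (fun z => exist _ _ (column_mem z)).
Proof.
move=> s z; apply/le_lres => t; rewrite sharp_comap /=.
have [_ dphi] := dmemP phiP; apply: le_trans (dphi (t, z)).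
have -> : (fun p : T X * Z => eval (p.1, exist _ _ (column_mem p.2))) = phi.
  by apply/funext => -[].
exact: kleisli_ub.
Qed.

Definition mate : tfunctor Z (psh X) := TFunctor mate_tfunctor.

End Mate.

Lemma str_mem (X : tcat th) : @dmem th Phi X X (@tstr th X).
Proof.
by apply: dmem_ext (hAx1 (tid X)) => t x; rewrite upper_starE.
Qed.

Definition yoneda (X : tcat th) : tfunctor X (psh X) := mate (str_mem X).

(** The Yoneda lemma: the value of a presheaf at t is the structure between the
image of t and the presheaf. *)
Lemma yoneda_star (X : tcat th) : lower_star (yoneda X) = @eval X.
Proof.
rewrite lower_star_psh -[RHS](lres_str (@eval_distributor X)).
by congr lres; apply/funext => -[].
Qed.

(** The columns of [eval] are the presheaves, which lie in Phi; so [Ax3]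
applies. *)
Lemma eval_mem (X : tcat th) : @dmem th Phi X (psh X) (@eval X).
Proof.
apply: hAx3 (@eval_distributor X) _ => psi.
apply: dmem_ext (svalP psi) => t [].
by rewrite kleisli_upper_star //; apply: eval_distributor.
Qed.

(** The colimit of h weighted by phi is the mate of the convolution of phi with
the relation of h.  That relation is the upper star of h after the lower star
of Yoneda, so [Ax2] keeps the convolution in Phi. *)
Lemma psh_colim (X Y Z : tcat th) (phi : trel th Y Z) (h : tfunctor Y (psh X)) :
  @dmem th Phi Y Z phi ->
  exists g : tfunctor Z (psh X), is_colim phi h g /\
    (fun p => eval (p.1, g p.2)) = kleisli phi (fun p => eval (p.1, h p.2)).
Proof.
move=> phiP; have dphi := dmemP phiP.
set ht := (X in kleisli _ X).
have phihP : @dmem th Phi X Z (kleisli phi ht).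
  have [_ /(_ _ h) /hAx2 [_ _ +] _] := hAx2 phiP.
  move=> /(_ _ (yoneda X)); rewrite yoneda_star => /(_ (@eval_mem X)).
  rewrite kleisliA (_ : kleisli (upper_star h) (@eval X) = ht) //.
  apply/funext => -[t y].
  by rewrite kleisli_upper_star //; apply: eval_distributor.
have gE : (fun p => eval (p.1, mate phihP p.2)) = kleisli phi ht.
  by apply/funext => -[].
exists (mate phihP); split => //; apply/is_colimP => //.
by rewrite !lower_star_psh gE lres_comp.
Qed.

Lemma psh_cocomplete (X : tcat th) : cocomplete Phi (psh X).
Proof. by move=> Y Z phi h /(@psh_colim X Y Z phi h) [g []]; exists g. Qed.

Lemma cocontinuous_colim (X Y A B : tcat th) (f : tfunctor X Y)
    (phi : trel th A B) (h : tfunctor A X) (k : tfunctor B X) :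
  separated Y -> cocontinuous Phi f -> @dmem th Phi A B phi ->
  is_colim phi h k -> is_colim phi (tcomp f h) (tcomp f k).
Proof.
by move=> sepY fc phiP kc; have [g [gc /sepY ->]] := fc _ _ _ _ _ phiP kc.
Qed.

(** The left Kan extension k = colim(eval, f) along Yoneda.  Its composite with
any T-functor g into presheaves has lower star the right extension of f along
the relation of g, and both claims follow by choosing g: Yoneda for the
triangle, a colimit of presheaves for cocontinuity. *)
Lemma psh_extend (X Y : tcat th) (f : tfunctor X Y) :
  separated Y -> cocomplete Phi Y ->
  exists k : tfunctor (psh X) Y, cocontinuous Phi k /\ tcomp k (yoneda X) = f.
Proof.
move=> sepY /(_ _ _ _ f (@eval_mem X)) [k kc].
have devX := @eval_distributor X; exists k.
have /(is_colimP _ _ devX) kE := kc.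
have kgE Z (g : tfunctor Z (psh X)) : lower_star (tcomp k g) =
    lres (lower_star f) (fun p => eval (p.1, g p.2)).
  by apply/funext => -[s y]; rewrite -lres_eval_map -kE !lower_starE TmapM.
split=> [A B phi h g phiP gc|]; last first.
  apply: lower_star_inj => //; rewrite kgE -[RHS]lres_str; last first.
    exact: lower_star_distributor.
  by congr lres; apply/funext => -[].
have dphi := dmemP phiP.
have [g' [g'c g'E]] := psh_colim h phiP.
have <- : g' = g.
  apply: lower_star_inj (@psh_separated X) _.
  by rewrite ((is_colimP _ _ dphi).1 g'c) ((is_colimP _ _ dphi).1 gc).
exists (tcomp k g'); split=> //; apply/is_colimP => //.
by rewrite !kgE g'E lres_comp.
Qed.

(** The identity of presheaves is the colimit of Yoneda weighted by [eval], as
every presheaf is a colimit of representables. *)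
Lemma psh_extend_unique (X Y : tcat th) (k k' : tfunctor (psh X) Y) :
    separated Y -> cocontinuous Phi k -> cocontinuous Phi k' ->
  tcomp k (yoneda X) = tcomp k' (yoneda X) -> k = k'.
Proof.
move=> sepY kc k'c kk'; apply: lower_star_inj => //.
have devX := @eval_distributor X.
have idc : @is_colim th _ X (psh X) (@eval X) (yoneda X) (tid (psh X)).
  apply/is_colimP => //; rewrite yoneda_star.
  by apply/funext => -[p psi]; rewrite lower_starE /= Tmap_id.
have kE (l : tfunctor (psh X) Y) : cocontinuous Phi l ->
    lower_star l = lres (lower_star (tcomp l (yoneda X))) (@eval X).
  move=> lc; apply/is_colimP => //.
  have := cocontinuous_colim sepY lc (@eval_mem X) idc.
  by rewrite (_ : tcomp l (tid _) = l) //; apply: tfunctor_eq.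
by rewrite !kE // kk'.
Qed.

End Presheaves.

(** * Reflective quotients *)

Section Quotients.
Variables (Phi : dist_class th) (hAx4 : Ax4 Phi).

(** The section is the colimit of the identity weighted by the lower star of f.
Since f preserves this colimit and is surjective, f g is the right extension
of lower star of f along itself, which is the structure of Y. *)
Lemma surjective_section (X Y : tcat th) (f : tfunctor X Y) :
    cocomplete Phi X -> separated Y -> cocontinuous Phi f ->
    (forall y, exists x, f x = y) ->
  exists g : tfunctor Y X,
    (forall y, f (g y) = y) /\ forall x, tle x (g (f x)).
Proof.
move=> ccX sepY fc surj; have fP := hAx4 surj; have df := dmemP fP.
have [g gc] := ccX _ _ _ (tid X) fP; exists g.
have fstar_refl t : qunit <= sharp (lower_star f) (t, Tmap f t).
  rewrite sharp_comap; apply: sharp_unit => x.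
  by rewrite lower_starE Tmap_e; apply: tstr_e.
split=> [y|x].
  suff fg1 : tcomp f g = tid Y.
    exact: (congr1 (fun k : tfunctor Y Y => k y) fg1).
  apply: lower_star_inj => //.
  have /(is_colimP _ _ df) -> := cocontinuous_colim sepY fc fP gc.
  have -> : tcomp f (tid X) = f by apply: tfunctor_eq.
  have [r rK] := choice surj.
  apply/funext => -[s y']; rewrite lower_starE /= Tmap_id.
  have rsK : Tmap f (Tmap r s) = s.
    by rewrite -TmapM -[RHS]Tmap_id; apply: eq_Tmap.
  apply: eq_from_below => v; rewrite le_lres.
  split=> [/(_ (Tmap r s)) | le_v t].
    rewrite lower_starE rsK; apply: le_trans.
    by rewrite -[leLHS]qtens1; apply: qtens_mono; rewrite -{2}rsK.
  apply: le_trans (df.2 (t, y')); apply: le_trans (kleisli_ub _ _ _ s _).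
  exact: tens_mono.
have /(is_colimP _ _ df) gE := gc.
have : tle (g (f x)) (g (f x)) by apply: tle_refl.
rewrite /tle -Tmap_e -lower_starE gE => /le_lres/(_ (e x)).
rewrite q1tens lower_starE /= Tmap_id; apply: le_trans.
by rewrite -Tmap_e.
Qed.

(** Inflation at points of X passes to every t of T X, because the structure
reindexed along n is still reflexive, so that [sharp_unit] applies to it. *)
Lemma closure_str (X : tcat th) (n : tfunctor X X) (t : T X) (x : X) :
  (forall y, tle y (n y)) ->
  @tstr th X (Tmap n t, x) <= @tstr th X (t, x).
Proof.
move=> infl; apply: le_trans (tstr_trans (t, x)).
apply: le_trans (kleisli_ub _ _ _ (Tmap n t) _).
rewrite -[leLHS]qtens1; apply: qtens_mono.
by rewrite sharp_comap; apply: sharp_unit.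
Qed.

Program Definition initial_tcat (P : tcat th) (X : Type) (f : X -> P) :
    tcat th :=
  @TCat th X (fun p => @tstr th P (Tmap f p.1, f p.2)) _ _.
Next Obligation.
move=> [t x]; rewrite [leLHS]vconvE.
have [<-|ex] := EM (e x = t); last by rewrite (graph_false _ ex) qbot_le.
by rewrite graph_true /= Tmap_e; apply: tstr_e.
Qed.
Next Obligation.
move=> [t x]; apply/kleisli_leP => s /=.
apply: le_trans (tstr_trans (Tmap f t, f x)).
apply: le_trans (kleisli_ub _ _ _ (Tmap f s) _); apply: qtens_mono.
exact: sharp_map.
Qed.

(** X is identified with the fixed points of n through x |-> n (s x), and has
the structure that makes this map fully faithful.  Then q is its left adjoint,
since n is inflationary, and colimits in X are images under q of colimits in
P. *)
Lemma closure_quotient (P : tcat th) (X : Type) (q : P -> X) (s : X -> P)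
    (n : tfunctor P P) :
    separated P -> cocomplete Phi P -> (forall x, q (s x) = x) ->
    (forall x, tle x (n x)) -> (forall x, q (n x) = q x) ->
    (forall x y, q x = q y -> n x = n y) ->
  let Y := initial_tcat (fun x => n (s x)) in
  [/\ separated Y, cocomplete Phi Y
    & exists q' : tfunctor P Y, cocontinuous Phi q' /\ (q' : P -> X) = q].
Proof.
move=> sepP ccP qs infl qn nq Y.
have nsq x : n (s (q x)) = n x by apply: nq; rewrite qs.
have nns x : n (n (s x)) = n (s x) by apply: nq; rewrite qn.
have qY : @is_tfunctor th P Y q.
  move=> t x; apply: le_trans (tfunP n t x) _.
  by rewrite /= nsq -TmapM (eq_Tmap _ nsq).
have sY : @is_tfunctor th Y P (fun x => n (s x)) by [].
pose q' := TFunctor qY; pose s' := TFunctor sY.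
have adj t y : @tstr th Y (Tmap q' t, y) = @tstr th P (t, s' y).
  rewrite /= -TmapM (eq_Tmap _ nsq).
  apply/le_anti; rewrite closure_str //=.
  by rewrite -[X in _ <= tstr (_, X)]nns; apply: tfunP.
have q'c : cocontinuous Phi q'.
  move=> A B phi h k phiP kc; exists (tcomp q' k); split=> //.
  exact: adjoint_colim adj (dmemP phiP) kc.
split; last by exists q'.
- apply/separatedP => x y xy yx.
  rewrite -[x]qs -[y]qs -[q (s x)]qn -[q (s y)]qn.
  by congr q; move/separatedP: sepP; apply; apply: (tle_mono s').
- move=> A B phi h phiP; have [k kc] := ccP _ _ _ (tcomp s' h) phiP.
  exists (tcomp q' k).
  have <- : tcomp q' (tcomp s' h) = h.
    by apply: tfunctor_eq; apply/funext => a; rewrite /= qn qs.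
  exact: adjoint_colim adj (dmemP phiP) kc.
Qed.

(** Every colimit in X is the image under q of a colimit in P of a diagram
lifted along s, and l = f q preserves the latter. *)
Lemma quotient_cocontinuous (P X Y : tcat th) (q : tfunctor P X)
    (s : tfunctor X P) (l : tfunctor P Y) (f : tfunctor X Y) :
    cocomplete Phi P -> separated X -> separated Y ->
    cocontinuous Phi q -> cocontinuous Phi l ->
    (forall x, q (s x) = x) -> (forall x, f (q x) = l x) ->
  cocontinuous Phi f.
Proof.
move=> ccP sepX sepY qc lc qs fq A B phi h k phiP kc.
have dphi := dmemP phiP.
have [k' k'c] := ccP _ _ _ (tcomp s h) phiP.
have qsh : tcomp q (tcomp s h) = h.
  by apply: tfunctor_eq; apply/funext => a; apply: qs.
have qk' : tcomp q k' = k.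
  apply: lower_star_inj => //; rewrite ((is_colimP _ _ dphi).1 kc).
  have /(is_colimP _ _ dphi) -> := cocontinuous_colim sepX qc phiP k'c.
  by rewrite qsh.
have := cocontinuous_colim sepY lc phiP k'c.
have -> : tcomp l (tcomp s h) = tcomp f h.
  by apply: tfunctor_eq; apply/funext => a; rewrite /= -fq qs.
have -> : tcomp l k' = tcomp f k.
  by rewrite -qk'; apply: tfunctor_eq; apply/funext => b; rewrite /= fq.
by exists (tcomp f k).
Qed.

(** With r x in Q over the pair (s (q x), x), inflation of u' u gives
x <= v (u' (s (q x))), and the right side depends only on the fibre of x: it is
an upper bound of the fibre, written as a mere function of x.  The composite n
is a T-functor which dominates it and stays in the fibre, so the two agree. *)
Lemma fibre_closure (P Q : tcat th) (X : Type) (u v : tfunctor Q P)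
    (u' v' : tfunctor P Q) (q : P -> X) (s : X -> P) (r : P -> Q) :
    separated P ->
    (forall x, u (u' x) = x) -> (forall y, tle y (u' (u y))) ->
    (forall x, v (v' x) = x) -> (forall y, tle y (v' (v y))) ->
    (forall x, u (r x) = s (q x)) -> (forall x, v (r x) = x) ->
    (forall x, q (s x) = x) -> (forall y, q (v y) = q (u y)) ->
  let n := tcomp v (tcomp u' (tcomp u v')) in
  [/\ forall x, tle x (n x), forall x, q (n x) = q x
    & forall x y, q x = q y -> n x = n y].
Proof.
move=> sepP uu' u'u vv' v'v ur vr qs qvu n.
have top x : tle x (v (u' (s (q x)))).
  by rewrite -{1}[x]vr -ur; apply/tle_mono/u'u.
have below x : tle (v (u' (s (q x)))) (n x).
  apply/tle_mono/tle_mono; rewrite -ur; apply: tle_mono.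
  by rewrite -{2}[x]vr; apply: v'v.
have qn x : q (n x) = q x by rewrite /= qvu uu' -qvu vv'.
have le_n x y : q x = q y -> tle (n x) (n y).
  move=> qxy; apply: tle_trans (below y).
  by rewrite -qxy -qn; apply: top.
split=> // [x|x y qxy]; first exact: tle_trans (top x) (below x).
by move/separatedP: sepP; apply; apply: le_n.
Qed.

End Quotients.
End Calculus.

(** * Monadicity *)

Local Open Scope cat_scope.

Section Monadicity.
Variables (th : strict_topological_theory) (Phi : dist_class th).
Hypotheses (hAx1 : Ax1 Phi) (hAx2 : Ax2 Phi) (hAx3 : Ax3 Phi) (hAx4 : Ax4 Phi).

Lemma free_tfunctorP (X : Type) (Y : tcat th) (f : X -> Y) :
  @is_tfunctor th (free_tcat th X) Y f.
Proof.
move=> t x; rewrite [leLHS]vconvE.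
have [<-|ex] := EM (Te th x = t); last by rewrite (graph_false _ ex) qbot_le.
by rewrite graph_true Tmap_e; apply: tstr_e.
Qed.

Definition free_cocont (X : Type) : cocont_obj Phi :=
  CocontObj (@psh_separated th Phi (free_tcat th X))
    (psh_cocomplete hAx1 hAx2 hAx3 (X := free_tcat th X)).

Definition free_unit (X : Type) : X -> free_cocont X :=
  yoneda hAx1 hAx2 (free_tcat th X).

Lemma free_unit_univ (X : Type) (Y : cocont_obj Phi) (f : X -> Y) :
  exists h : cocont_hom (free_cocont X) Y, (fun x => h (free_unit x)) = f.
Proof.
have [k [kc kf]] := psh_extend hAx1 hAx2 hAx3 (TFunctor (free_tfunctorP f))
  (@cocont_sep _ _ Y) (@cocont_cocomplete _ _ Y).
exists (@CocontHom _ Phi (free_cocont X) Y k kc).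
by rewrite -[RHS]/(tfun (TFunctor (free_tfunctorP f))) -kf.
Qed.

Lemma free_unit_inj (X : Type) (Y : cocont_obj Phi)
    (h k : cocont_hom (free_cocont X) Y) :
  (fun x => h (free_unit x)) = (fun x => k (free_unit x)) -> h = k.
Proof.
move=> hk; apply: cocont_hom_eq; congr tfun.
apply: (@psh_extend_unique th Phi hAx1 hAx2 hAx3 (free_tcat th X) Y
  (cocont_fun h) (cocont_fun k) (@cocont_sep _ _ Y)).
- exact: (cocont_funP h).
- exact: (cocont_funP k).
- exact: tfunctor_eq.
Qed.

Definition forgetful_left_adjoint : left_adjoint (forgetful Phi) :=
  @universal_left_adjoint (Cocont_sep Phi) SetCat (forgetful Phi) free_cocont
    free_unit free_unit_univ free_unit_inj.

Section Comparison.
Variable F : left_adjoint (forgetful Phi).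

Local Notation eta X := (adj_unit F X : X -> (F X : cocont_obj Phi)).
Local Notation counit Y :=
  (adj_counit F Y : cocont_hom (F (Y : Type) : cocont_obj Phi) Y).

Lemma counit_unit (Y : cocont_obj Phi) (y : Y) : counit Y (eta Y y) = y.
Proof. exact: (congr1 (fun f => f y) (adj_triangleG F Y)). Qed.

Lemma counit_section (Y : cocont_obj Phi) :
  exists g : tfunctor Y (F (Y : Type) : cocont_obj Phi),
    (forall y, counit Y (g y) = y) /\ forall x, tle x (g (counit Y x)).
Proof.
apply: (surjective_section hAx4).
- exact: cocont_cocomplete.
- exact: cocont_sep.
- exact: cocont_funP.
- by move=> y; exists (eta Y y); apply: counit_unit.
Qed.

Lemma comparison_faithful (Y Z : cocont_obj Phi) (f g : cocont_hom Y Z) :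
  fmap (comparison F) f = fmap (comparison F) g -> f = g.
Proof. by move=> /(congr1 (@alg_map _ _ _ _)); apply: cocont_hom_eq. Qed.

(** The underlying map f of a homomorphism satisfies f o counit = l with l
cocontinuous, and the counit has a T-functor section. *)
Lemma comparison_full (Y Z : cocont_obj Phi)
    (h : alg_hom (comparison F Y) (comparison F Z)) :
  exists f : cocont_hom Y Z, fmap (comparison F) f = h.
Proof.
pose f : Y -> Z := alg_map h.
pose l : cocont_hom (F (Y : Type) : cocont_obj Phi) Z :=
  @mcomp (Cocont_sep Phi) _ _ _ (counit Z) (fmap F (f : hom (Y : SetCat) Z)).
have fl x : f (counit Y x) = l x.
  exact: (congr1 (fun k => k x) (alg_mapP h)).
have [g [gK _]] := counit_section Y.
have fP : is_tfunctor f.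
  have -> : f = tcomp l g.
    by apply/funext => y; rewrite -[y in LHS]gK; apply: fl.
  exact: tfunP.
have fc : cocontinuous Phi (TFunctor fP).
  apply: (quotient_cocontinuous (q := counit Y) (s := g) (l := l)) => //.
  - exact: cocont_cocomplete.
  - exact: cocont_sep.
  - exact: cocont_sep.
  - exact: cocont_funP.
  - exact: cocont_funP.
exists (CocontHom fc); exact: alg_hom_eq.
Qed.

(** The quotient structure on the carrier makes q cocontinuous; as q restricts
to the identity along the unit, it is the counit, and the identity map is an
isomorphism of algebras. *)
Lemma comparison_surj (X : algebra (adj_monad F)) :
  exists (Y : cocont_obj Phi) (i : alg_hom (comparison F Y) X)
    (j : alg_hom X (comparison F Y)),
    alg_comp i j = alg_id X /\ alg_comp j i = alg_id (comparison F Y).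
Proof.
case: X => X q qP; have [qs qm] := qP.
pose P : cocont_obj Phi := F X; pose Q : cocont_obj Phi := F (P : Type).
pose u : cocont_hom Q P := fmap F q.
pose v : cocont_hom Q P := counit P.
have ur x : u (eta P x) = eta X (q x).
  exact/esym/(congr1 (fun k => k x) (adj_unit_nat F q)).
have qsE x : q (eta X x) = x by exact: (congr1 (fun k => k x) qs).
have qmE y : q (v y) = q (u y) by exact: (congr1 (fun k => k y) qm).
have usurj x : exists y, u y = x.
  exists ((fmap F (adj_unit F X) : cocont_hom P Q) x).
  have uF : @mcomp (Cocont_sep Phi) _ _ _ (fmap F q) (fmap F (adj_unit F X)) =
      @idm (Cocont_sep Phi) P.
    by rewrite -fmapM [_ \oc _]qs fmap1.
  exact: (congr1 (fun k : cocont_hom P P => k x) uF).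
have [g [ug gu]] := surjective_section hAx4 (@cocont_cocomplete _ _ Q)
  (@cocont_sep _ _ P) (cocont_funP u) usurj.
have [w [vw wv]] := counit_section P.
have [infl qn nq] := fibre_closure (@cocont_sep _ _ P) ug gu vw wv ur
  (@counit_unit P) qsE qmE.
have [sepY ccY [q' [q'c q'E]]] := closure_quotient (@cocont_sep _ _ P)
  (@cocont_cocomplete _ _ P) qsE infl qn nq.
pose Y := CocontObj sepY ccY.
have counitE : counit Y = @CocontHom _ Phi P Y q' q'c.
  apply: (@adj_unit_inj _ _ (forgetful Phi) F).
  apply/funext => x; apply: etrans (@counit_unit Y x) _.
  by rewrite /= q'E qsE.
have fmap_id : fmap (adj_monad F) (idm X) = idm (adj_monad F X) by apply: fmap1.
have counitq : fmap (forgetful Phi) (counit Y) = q by rewrite counitE.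
have toP : idm X \oc fmap (forgetful Phi) (counit Y) =
    q \oc fmap (adj_monad F) (idm X).
  by rewrite fmap_id mcompm1 mcomp1m.
have fromP : idm X \oc q =
    fmap (forgetful Phi) (counit Y) \oc fmap (adj_monad F) (idm X).
  by rewrite fmap_id mcompm1 mcomp1m.
exists Y, (@AlgHom _ _ (comparison F Y) (Algebra qP) (idm X) toP).
exists (@AlgHom _ _ (Algebra qP) (comparison F Y) (idm X) fromP).
by split; apply: alg_hom_eq.
Qed.

End Comparison.
End Monadicity.

Theorem mainTheorem2 (th : strict_topological_theory) (Phi : dist_class th)
  (hAx1 : Ax1 Phi) (hAx2 : Ax2 Phi) (hAx3 : Ax3 Phi) (hAx4 : Ax4 Phi) :
  monadic (forgetful Phi).
Proof.
exists (forgetful_left_adjoint hAx1 hAx2 hAx3).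
apply: fully_faithful_equivalence.
- exact: comparison_faithful.
- exact: comparison_full.
- exact: comparison_surj.
Qed.
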